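(* Let $\alpha,\beta>-1$ and consider the product Laguerre weight, with $\mathbb{Q}_n,\mathbb{S}_n,\mathbf{C}_n,\mathbf{D}_n$ and $\mathbf{A}_n$ as in the context. Let $\mathbf{H}_n^\nabla:=\langle\mathbb{S}_n,\mathbb{S}_n^{\mathsf T}\rangle_\nabla$. Then $\mathbf{H}_n^\nabla$ satisfies the recursive relation $$\mathbf{H}_n^\nabla=\mathbf{D}_n-\mathbf{C}_{n-1}(\mathbf{H}_{n-1}^\nabla)^{-1}\mathbf{C}_{n-1}^{\mathsf T}\qquad(n\ge2),$$ where the iteration is initiated by $\mathbf{H}_1^\nabla=\mathbf{I}$, the identity matrix. Furthermore, for $n=1,2,\ldots$, the matrix $\mathbf{A}_n$ in the relation $\mathbb{Q}_{n+1}\doteq\mathbb{S}_{n+1}+\mathbf{A}_n\mathbb{S}_n$ is determined by $$\mathbf{A}_n=\mathbf{C}_n(\mathbf{H}_n^\nabla)^{-1}.$$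
   Context: For $\alpha>-1$ let $w_\alpha(x)=x^\alpha e^{-x}$ on $[0,\infty)$, let $p_n(w_\alpha;\cdot)$ be its monic orthogonal polynomial of degree $n$ ($p_n(w_\alpha;x)=(-1)^nn!L_n^\alpha(x)$), and let $q_0(w_\alpha;x)=1$, $q_n(w_\alpha;x)=p_n(w_\alpha;x)+np_{n-1}(w_\alpha;x)$ for $n\ge1$. For $0\le k\le n$ put $Q_k^n(x,y)=q_{n-k}(w_\alpha;x)q_k(w_\beta;y)$ and $\mathbb{Q}_n=(Q_0^n,\dots,Q_n^n)^{\mathsf T}$. Let $W_{\alpha,\beta}(x,y)=w_\alpha(x)w_\beta(y)$ on $[0,\infty)^2$, $c_{\alpha,\beta}=1/\int_{[0,\infty)^2}W_{\alpha,\beta}$, and $$\langle f,g\rangle_\nabla=c_{\alpha,\beta}\int_{[0,\infty)^2}\nabla f\cdot\nabla g\,W_{\alpha,\beta}\,dx\,dy.$$ For column vectors of polynomials $\mathbb{F},\mathbb{G}$, $\langle\mathbb{F},\mathbb{G}^{\mathsf T}\rangle_\nabla$ is the matrix of entries $\langle F_i,G_j\rangle_\nabla$. Let $\Pi_n^2$ be the space of real polynomials in $x,y$ of total degree at most $n$. For $n\ge1$, $0\le k\le n$, $S_k^n$ is a monic orthogonal polynomial for $\langle\cdot,\cdot\rangle_\nabla$: $S_k^n-x^{n-k}y^k\in\Pi_{n-1}^2$ and $\langle S_k^n,P\rangle_\nabla=0$ for all $P\in\Pi_{n-1}^2$ (determined up to an additive constant); $\mathbb{S}_n=(S_0^n,\dots,S_n^n)^{\mathsf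 T}$. Put $\mathbf{C}_n=\langle\mathbb{Q}_{n+1},\mathbb{Q}_n^{\mathsf T}\rangle_\nabla$ and $\mathbf{D}_n=\langle\mathbb{Q}_n,\mathbb{Q}_n^{\mathsf T}\rangle_\nabla$. Write $f\doteq g$ if $f-g$ is constant (componentwise for vectors). For the product Laguerre weight there are real matrices $\mathbf{A}_{n-1}$ with $\mathbb{Q}_n\doteq\mathbb{S}_n+\mathbf{A}_{n-1}\mathbb{S}_{n-1}$ for $n\ge2$. *)

(* Defs.v *)
From HB Require Import structures.
From mathcomp Require Export all_boot all_order all_algebra.
From mathcomp Require Export all_classical all_reals all_analysis.
Export Order.TTheory GRing.Theory Num.Theory.
Export numFieldNormedType.Exports.

Set Implicit Arguments.
Unset Strict Implicit.
Unset Printing Implicit Defensive.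

Local Open Scope classical_set_scope.
Local Open Scope ring_scope.

(* Bivariate real polynomials are elements of {poly {poly R}} with the
   conventions of polyXY: the variable x is the outer indeterminate 'X, the
   variable y is the inner one 'Y = 'X%:P, and f.[x, y] is the value at (x, y).
   The coefficient of x^i y^j in f is therefore f`_i`_j. *)

Section Laguerre.
Context {R : realType}.
Implicit Types (w : R -> R) (p : nat -> {poly R}) (a b : R).

Definition laguerre_weight a (x : R) : R := x `^ a * expR (- x).

Definition monic_orthogonal w (n : nat) (P : {poly R}) : Prop :=
  [/\ P \is monic, size P = n.+1 &
      forall T : {poly R}, (size T <= n)%N ->
        \int[@lebesgue_measure R]_(x in `[0, +oo[) (P.[x] * T.[x] * w x) = 0].

Definition q_of p (n : nat) : {poly R} :=
  if n is m.+1 then p n + n%:R *: p m else 1.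

Definition Qvec (pa pb : nat -> {poly R}) (n : nat) :
    'cV[{poly {poly R}}]_n.+1 :=
  \col_(k < n.+1) ((q_of pa (n - k))^:P * (q_of pb k)%:P).

Definition quadrant : set (R * R) := `[0, +oo[ `*` `[0, +oo[.

Definition lebesgue2 := (@lebesgue_measure R \x @lebesgue_measure R)%E.

Definition product_weight a b (z : R * R) : R :=
  laguerre_weight a z.1 * laguerre_weight b z.2.

Definition normalization a b : R :=
  (\int[lebesgue2]_(z in quadrant) product_weight a b z)^-1.

Definition dx (f : {poly {poly R}}) : {poly {poly R}} := f^`().
Definition dy (f : {poly {poly R}}) : {poly {poly R}} := map_poly deriv f.

Definition grad_ip a b (f g : {poly {poly R}}) : R :=
  normalization a b *
  \int[lebesgue2]_(z in quadrant)
    (((dx f).[z.1, z.2] * (dx g).[z.1, z.2]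
      + (dy f).[z.1, z.2] * (dy g).[z.1, z.2]) * product_weight a b z).

Definition grad_mx a b m n (F : 'cV[{poly {poly R}}]_m)
    (G : 'cV[{poly {poly R}}]_n) : 'M[R]_(m, n) :=
  \matrix_(i < m, j < n) grad_ip a b (F i 0) (G j 0).

Definition total_degree_le (n : nat) (f : {poly {poly R}}) : Prop :=
  forall i j : nat, (n < i + j)%N -> f`_i`_j = 0.

Definition monic_sobolev_orthogonal a b (n k : nat) (f : {poly {poly R}}) :
    Prop :=
  total_degree_le n.-1 (f - 'X^(n - k) * 'Y ^+ k) /\
  (forall g, total_degree_le n.-1 g -> grad_ip a b f g = 0).

Definition eq_upto_const m (F G : 'cV[{poly {poly R}}]_m) : Prop :=
  forall i, exists c : R, F i 0 - G i 0 = c%:P%:P.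

Definition const_mx_poly m n (A : 'M[R]_(m, n)) : 'M[{poly {poly R}}]_(m, n) :=
  map_mx (fun c : R => c%:P%:P) A.

End Laguerre.

(* Main.v *)
(* Integrating by parts, the functional f |-> int f w_a satisfies
   L(x f') = L((x - a - 1) f), so that p_n solves Laguerre's equation and, from
   it, q_n' = n p_(n-1). Both partial derivatives of Q_k^n are then products of
   an orthogonal polynomial and some q_j, and Q_(n+1) is orthogonal to all
   polynomials of degree < n. Since the gradient form only degenerates on
   constants, Q_(n+1) - S_(n+1), of degree <= n and orthogonal to degree < n, is
   a combination A S_n up to constants. Pairing with Q_n and with Q_(n+1)
   yields C_n = A H_n and D_(n+1) = H_(n+1) + A H_n A^T. *)
From HB Require Import structures.
Require Import Defs.
From mathcomp Require Import ring lra zify measurable_realfun.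
From mathcomp Require polyrcf.

Set Implicit Arguments.
Unset Strict Implicit.
Unset Printing Implicit Defensive.

Local Open Scope classical_set_scope.
Local Open Scope ring_scope.

(** * Laguerre functionals and coherence *)

(** The algebra never meets an integral. It works with a linear functional on [{poly R}] that is
    positive and satisfies Pearson's identity; the double integral becomes one functional acting on
    the coefficients, followed by another. Coherence explains why two terms suffice: q_n and q_n'
    are both orthogonal to degree < n - 1, and taking the gradient of a test polynomial lowers its
    degree by one, so the orthogonality of Q_(n+1) stops just one degree below that of S_(n+1). On
    the analytic side everything reduces to the integrals of x^(b-1) e^-x with b = a + 1 + n > 0 and
    to Gamma(b+1) = b Gamma(b), which is Pearson's identity read on monomials. The obstacle is 0 < b
    < 1, where the integrand is unbounded at 0: it is compared on ]0, +oo[ with an explicit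
    derivative whose antiderivative has limits at both ends. *)

Section Moment.
Context {R : realFieldType}.
Implicit Types (L : {scalar {poly R}}) (P T : {poly R}) (a : R).

(** Asked for nonnegative polynomials, not only for squares: integrating one variable out of a
    square f * f leaves a nonnegative polynomial that is not given as a square. *)
Definition positive_functional L :=
  forall P, (forall x, 0 <= x -> 0 <= P.[x]) -> 0 <= L P /\ (L P = 0 -> P = 0).

(** The weak form of Pearson's equation (x w)' = (a + 1 - x) w for w = x^a e^-x. *)
Definition pearson a L :=
  forall P, L ('X * P^`()) = L (('X - (a + 1)%:P) * P).

Definition orthogonal_poly L n P :=
  [/\ P \is monic, size P = n.+1 &
      forall T, (size T <= n)%N -> L (P * T) = 0].

Lemma functional_sqr_eq0 L P : positive_functional L -> L (P * P) = 0 -> P = 0.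
Proof.
move=> Lpos LPP; apply/eqP; rewrite -[_ == 0]orbb -mulf_eq0; apply/eqP.
have [x _|_ ->//] := Lpos (P * P).
by rewrite hornerM -expr2 sqr_ge0.
Qed.

(** The Laguerre operator is symmetric for [L] and does not raise degrees, so the left-hand side V
    inherits from P the orthogonality to degree < n. The eigenvalue n cancels the coefficient of
    x^n, so V itself has degree < n and L(V V) = 0. *)
Lemma laguerre_ode a L n P : positive_functional L -> pearson a L ->
  orthogonal_poly L n P ->
  'X * P^`()^`() + ((a + 1)%:P - 'X) * P^`() + n%:R * P = 0.
Proof.
move=> Lpos La [Pm sP PT]; set V := (X in X = 0).
have VT T : (size T <= n)%N -> L (V * T) = 0.
  move=> sT.
  (* Pearson's identity for P' T and for P T' removes the first four terms and leaves P times the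
     operator applied to T. *)
  have -> : V * T = 'X * (P^`() * T)^`() - ('X - (a + 1)%:P) * (P^`() * T)
      - 'X * (P * T^`())^`() + ('X - (a + 1)%:P) * (P * T^`())
      + P * ('X * T^`()^`() + ((a + 1)%:P - 'X) * T^`() + n%:R * T).
    by rewrite /V !derivM; ring.
  rewrite !(linearB, linearD) /= !La subrr sub0r addNr add0r.
  apply: PT.
  have sT'' : (size ('X * T^`()^`())%R <= n)%N.
    apply/leq_sizeP => k nk; rewrite coefXM; case: k nk => [//|k] nk /=.
    by rewrite !coef_deriv (leq_sizeP _ _ sT) ?mul0rn// ltnW.
  have sXT' : (size (((a + 1)%:P - 'X) * T^`())%R <= n)%N.
    apply/leq_sizeP => k nk; rewrite mulrBl coefB coefCM coefXM.
    case: k nk => [|k] nk; rewrite !coef_deriv !(leq_sizeP _ _ sT) ?mul0rn ?mulr0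
      ?subr0//; by rewrite leqW.
  rewrite (leq_trans (size_polyD _ _))// geq_max
    (leq_trans (size_polyD _ _)) ?geq_max ?sT''//=.
  by rewrite -polyC_natr mul_polyC (leq_trans (size_scale_leq _ _)).
apply: (functional_sqr_eq0 Lpos); apply: VT.
have Pn : P`_n = 1 by move/monicP: Pm; rewrite /lead_coef sP.
have Pk k : (n < k)%N -> P`_k = 0 by move=> nk; rewrite nth_default// sP.
apply/leq_sizeP => k nk.
rewrite /V mulrBl !(coefD, coefN) coefCM -polyC_natr coefCM !coefXM !coef_deriv.
rewrite (Pk k.+1)// mul0rn mulr0 add0r.
case: k nk => [|k] nk /=.
  have -> : n = 0%N by apply/eqP; rewrite -leqn0.
  by rewrite mul0r; ring.
rewrite (Pk k.+2 nk) !mul0rn.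
move: nk; rewrite leq_eqVlt => /predU1P[->|nk]; last by rewrite Pk// mul0rn; ring.
by rewrite !(add0r, mulr0) mulr_natl addNr.
Qed.

(* The defect r := q' - (n+1) P0 of the claimed identity has degree < n and
   solves x r'' + (a + 2 - x) r' + n r = 0, in which a term of degree d < n
   cannot be leading. *)
Lemma laguerre_coherence a L n P P0 : positive_functional L -> pearson a L ->
  orthogonal_poly L n.+1 P -> orthogonal_poly L n P0 ->
  (P + n.+1%:R *: P0)^`() = n.+1%:R *: P0.
Proof.
move=> Lpos La PO P0O.
have ode' (b c : R) (p : {poly R}) :
    'X * p^`()^`() + (b%:P - 'X) * p^`() + c%:P * p = 0 ->
    'X * p^`()^`()^`() + ((b + 1)%:P - 'X) * p^`()^`() + (c - 1)%:P * p^`() = 0.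
  move=> /(congr1 (@deriv R)); rewrite deriv0 => <-.
  by rewrite !(derivD, derivM, derivN, derivC, derivX) !polyCD polyCN polyC1; ring.
have := laguerre_ode Lpos La PO; have := laguerre_ode Lpos La P0O.
rewrite -!polyC_natr => E0 E1; have := ode' _ _ _ E0; have := ode' _ _ _ E1.
move: PO P0O => [Pm sP _] [P0m sP0 _].
rewrite -!mul_polyC => D1 D0; clear E1.
apply/eqP; rewrite -subr_eq0; set r := (X in X == 0).
(* This operator kills P' (differentiated equation of P) and sends both P0' and P0 to P0', so the
   two multiples of P0' cancel. *)
have rE : 'X * r^`()^`() + ((a + 2)%:P - 'X) * r^`() + n%:R%:P * r = 0.
  rewrite /r !(derivD, derivM, derivN, derivC) ?(mul0r, add0r).
  rewrite -[RHS](_ : 0 + n.+1%:R%:P * 0 - n.+1%:R%:P * 0 = 0); last by ring.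
  rewrite -{1}D1 -{1}D0 -E0 -natr1 !(polyCD, polyCN) polyC_natr polyC1.
  by ring.
apply/negP => /negP r0; have := lead_coefE r.
have sr : (size r <= n)%N.
  apply/leq_sizeP => k nk.
  rewrite /r derivD derivM derivC mul0r add0r !(coefD, coefN) !coefCM !coef_deriv.
  rewrite (_ : P0`_k.+1 = 0); last by rewrite nth_default// sP0.
  move: nk; rewrite leq_eqVlt => /predU1P[<-|nk].
    move: Pm P0m; rewrite !monicE /lead_coef sP sP0/= => /eqP -> /eqP ->.
    by rewrite mul0rn -mulr_natr; ring.
  by rewrite !nth_default ?sP ?sP0// !mul0rn; ring.
move: r0; rewrite -lead_coef_eq0 /lead_coef.
case E : (size r) => [|d]; first by rewrite nth_default ?eqxx// E.
move=> /= rd0 _; move: sr; rewrite E => dn.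
(* At the leading degree d the equation reads (n - d) r_d = 0, with d < n. *)
have /(congr1 (fun p : {poly R} => p`_d)) := rE.
rewrite mulrBl !(coefD, coefN) !coefCM !coefXM coef0.
have rk k : (d < k)%N -> r`_k = 0 by move=> dk; rewrite nth_default// E.
case: d E dn rd0 rk => [|d] E dn rd0 rk /=; rewrite !coef_deriv !(rk _ (ltnSn _)) ?mul0rn.
  move=> /eqP; rewrite mulr0 !add0r oppr0 add0r mulf_eq0. rewrite (negbTE rd0) orbF.
  by rewrite pnatr_eq0; case: (n) dn.
move=> /eqP; rewrite mulr0 !add0r -(mulr_natl (r`_d.+1)) -mulNr -mulrDl mulf_eq0.
rewrite (negbTE rd0) orbF.
by rewrite addrC subr_eq0 eqr_nat => /eqP nd; rewrite nd ltnn in dn.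
Qed.

End Moment.

(** * Tensor product functionals *)

(** Used with coefficients in [{poly R}]: the integers are a supply of infinitely many distinct
    points there. *)
Lemma eq_poly0_nat (A : idomainType) (p : {poly A}) :
  injective (fun n => n%:R : A) -> (forall n : nat, p.[n%:R] = 0) -> p = 0.
Proof.
move=> inj p0; apply/eqP; apply: contraT => pN0.
have := max_poly_roots pN0 (rs := [seq n%:R | n <- iota 0 (size p)]).
rewrite size_map size_iota ltnn; apply.
  by apply/allP => _ /mapP[n _ ->]; rewrite /root p0.
by rewrite map_inj_uniq ?iota_uniq.
Qed.

Section Tensor.
Context {R : realFieldType}.
Implicit Types (L La Lb : {scalar {poly R}}) (P T : {poly R}).
Implicit Types (f g : {poly {poly R}}).

Definition tensor_functional La Lb f := La (map_poly Lb f).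

Lemma coef_tensor P T i j : (P^:P * T%:P)`_i`_j = P`_i * T`_j.
Proof. by rewrite coefMC coef_map coefCM. Qed.

Lemma tensor_functionalD La Lb : {morph tensor_functional La Lb : f g / f + g}.
Proof. by move=> f g; rewrite /tensor_functional !raddfD. Qed.

Lemma tensor_functionalM La Lb P T f :
  tensor_functional La Lb (P^:P * T%:P * f)
  = La (P * map_poly (fun q => Lb (T * q)) f).
Proof.
congr (La _); apply/polyP => k; rewrite coef_map /=.
rewrite -mulrA coefM [in RHS]coefM linear_sum /=.
apply: eq_bigr => i _; rewrite [in RHS]coef_map_id0 ?mulr0 ?linear0//.
by rewrite coef_map /= coefCM mul_polyC linearZ.
Qed.

Lemma tensor_functionalZ La Lb (c : R) f :
  tensor_functional La Lb (c%:P%:P * f) = c * tensor_functional La Lb f.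
Proof.
have -> : c%:P%:P * f = (c%:P)^:P * 1%:P * f :> {poly {poly R}}.
  by rewrite map_polyC /= polyC1 mulr1.
rewrite tensor_functionalM mul_polyC linearZ /=; congr (_ * La _).
by apply/polyP => k; rewrite coef_map coef_map_id0 ?mul1r ?linear0.
Qed.

(** [f] may have high degree in either variable alone. For i >= r the coefficient of x^i has
    y-degree below s, so [Lb] kills it; what reaches [La] has degree below r. *)
Lemma tensor_functional_orthogonal La Lb P T r s f :
  (forall q : {poly R}, (size q <= r)%N -> La (P * q) = 0) ->
  (forall q : {poly R}, (size q <= s)%N -> Lb (T * q) = 0) ->
  (forall i j, (r <= i)%N -> (s <= j)%N -> f`_i`_j = 0) ->
  tensor_functional La Lb (P^:P * T%:P * f) = 0.
Proof.
move=> LaP LbT f0; rewrite tensor_functionalM; apply: LaP.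
apply/leq_sizeP => i ri; rewrite coef_map_id0 ?mulr0 ?linear0//.
by apply: LbT; apply/leq_sizeP => j sj; apply: f0.
Qed.

Lemma horner_map_functional L f x : (map_poly L f).[x] = L f.[x%:P].
Proof.
rewrite (@horner_coef_wide _ (size f)) ?size_poly// horner_coef linear_sum.
apply: eq_bigr => i _.
by rewrite coef_map -polyC_exp mulrC [in RHS]mulrC mul_polyC linearZ.
Qed.

(** For fixed x, [Lb] of f(x, .)^2 is nonnegative, and it is polynomial in x. If [La] sends it to 0
    it vanishes identically, so f(x, .) = 0 at every integer x. *)
Lemma tensor_functional_sqr La Lb f :
  positive_functional La -> positive_functional Lb ->
  0 <= tensor_functional La Lb (f * f) /\
  (tensor_functional La Lb (f * f) = 0 -> f = 0).
Proof.
move=> pa pb; have fx x : 0 <= (map_poly Lb (f * f)).[x].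
  rewrite horner_map_functional hornerM.
  by have [y _|] := pb (f.[x%:P] * f.[x%:P]); first by rewrite hornerM -expr2 sqr_ge0.
have [//|La_ge0 La_eq0] := pa (map_poly Lb (f * f)).
split=> // /La_eq0 ff0; apply: eq_poly0_nat.
  move=> m n /eqP; rewrite -!polyC_natr => /eqP/polyC_inj/eqP.
  by rewrite eqr_nat => /eqP.
move=> n; apply: (functional_sqr_eq0 pb).
by rewrite -hornerM -polyC_natr -horner_map_functional ff0 horner0.
Qed.

End Tensor.

(** * Coefficients, gradients and total degree of bivariate polynomials *)

Section TotalDegree.
Context {R : realType}.
Implicit Types (f g : {poly {poly R}}) (P T : {poly R}) (c : R).

Lemma poly2P f g : (forall i j, f`_i`_j = g`_i`_j) -> f = g.
Proof. by move=> fg; apply/polyP => i; apply/polyP. Qed.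

Lemma coef_scale2 c f i j : (c%:P%:P * f)`_i`_j = c * f`_i`_j.
Proof. by rewrite !coefCM. Qed.

Lemma coef_const2 c i j : (c%:P%:P : {poly {poly R}})`_i`_j =
  if (i + j == 0)%N then c else 0.
Proof. by rewrite coefC; case: i => [|i]; rewrite ?coef0 ?coefC//=; case: j. Qed.

Lemma coef_dx f i j : (dx f)`_i`_j = f`_i.+1`_j *+ i.+1.
Proof. by rewrite /dx coef_deriv coefMn. Qed.

Lemma coef_dy f i j : (dy f)`_i`_j = f`_i`_j.+1 *+ j.+1.
Proof. by rewrite /dy coef_map /= coef_deriv. Qed.

Lemma dx_tensor P T : dx (P^:P * T%:P) = (P^`())^:P * T%:P.
Proof. by apply: poly2P => i j; rewrite coef_dx !coef_tensor coef_deriv mulrnAl. Qed.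

Lemma dy_tensor P T : dy (P^:P * T%:P) = P^:P * (T^`())%:P.
Proof. by apply: poly2P => i j; rewrite coef_dy !coef_tensor coef_deriv mulrnAr. Qed.

Lemma dxD f g : dx (f + g) = dx f + dx g. Proof. exact: derivD. Qed.

Lemma dyD f g : dy (f + g) = dy f + dy g. Proof. exact: raddfD. Qed.

Lemma dxZ c f : dx (c%:P%:P * f) = c%:P%:P * dx f.
Proof. by apply: poly2P => i j; rewrite !(coef_dx, coef_scale2) mulrnAr. Qed.

Lemma dyZ c f : dy (c%:P%:P * f) = c%:P%:P * dy f.
Proof. by apply: poly2P => i j; rewrite !(coef_dy, coef_scale2) mulrnAr. Qed.

Lemma dx_const c : dx c%:P%:P = 0. Proof. exact: derivC. Qed.

Lemma dy_const c : dy c%:P%:P = 0.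
Proof. by rewrite /dy map_polyC /= derivC. Qed.

Lemma grad_eq0 f : dx f = 0 -> dy f = 0 -> f = (f`_0`_0)%:P%:P.
Proof.
move=> fx fy; apply: poly2P => i j; rewrite coef_const2.
case: i => [|i]; last first.
  have /eqP : (dx f)`_i`_j = 0 by rewrite fx !coef0.
  by rewrite coef_dx mulrn_eq0 /= => /eqP.
case: j => [//|j]; have /eqP : (dy f)`_0`_j = 0 by rewrite fy !coef0.
by rewrite coef_dy mulrn_eq0 /= => /eqP.
Qed.

Lemma total_degree_leB n f g : total_degree_le n f -> total_degree_le n g ->
  total_degree_le n (f - g).
Proof. by move=> hf hg i j nij; rewrite !coefB hf ?hg ?subr0. Qed.

Lemma total_degree_leS m n f : (m <= n)%N -> total_degree_le m f ->
  total_degree_le n f.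
Proof. by move=> mn hf i j nij; rewrite hf ?(leq_ltn_trans mn). Qed.

Lemma coef_monomial2 m k i j :
  ('X^m * 'Y ^+ k : {poly {poly R}})`_i`_j = ((i == m) && (j == k))%:R.
Proof.
rewrite -polyC_exp -(map_polyXn polyC) coef_tensor !coefXn.
by case: eqP; rewrite ?mul0r ?mul1r.
Qed.

Lemma monic_tensor_subr_monomial m k P T : P \is monic -> T \is monic ->
  size P = m.+1 -> size T = k.+1 ->
  total_degree_le (m + k).-1 (P^:P * T%:P - 'X^m * 'Y ^+ k).
Proof.
move=> Pm Tm sP sT i j mkij; rewrite !coefB coef_tensor coef_monomial2.
have Pi l : (m < l)%N -> P`_l = 0 by move=> ml; rewrite nth_default// sP.
have Tj l : (k < l)%N -> T`_l = 0 by move=> kl; rewrite nth_default// sT.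
have P1 : P`_m = 1 by move/monicP: Pm; rewrite /lead_coef sP.
have T1 : T`_k = 1 by move/monicP: Tm; rewrite /lead_coef sT.
case: (ltngtP i m) mkij => [im|mi|->] mkij; last 1 first.
- case: (ltngtP j k) mkij => [jk|kj|->] mkij; last by rewrite P1 T1 mul1r subrr.
    by exfalso; lia.
  by rewrite Tj// mulr0 subrr.
- by rewrite Tj ?mulr0 ?subrr//; lia.
- by rewrite Pi// mul0r subrr.
Qed.

End TotalDegree.

(** * The Sobolev recursion *)

Section CoherentPolynomials.
Context {R : realType} (a : R) (L : {scalar {poly R}}) (p : nat -> {poly R}).
Hypotheses (Lpos : positive_functional L) (La : pearson a L).
Hypothesis Op : forall n, orthogonal_poly L n (p n).

Lemma q_of_monic n : q_of p n \is monic /\ size (q_of p n) = n.+1.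
Proof.
case: n => [|n]; first by rewrite monic1 size_poly1.
have [pm sp _] := Op n.+1; have [_ sp' _] := Op n.
have lt_s : (size (n.+1%:R *: p n) < size (p n.+1))%N.
  by rewrite sp ltnS -sp' size_scale_leq.
by rewrite /= monicE lead_coefDl// size_polyDl// sp; split=> //; apply/eqP/monicP.
Qed.

(** At n = 0 the truncated index [n.-1] is harmless, as the factor n vanishes. *)
Lemma q_of_deriv n : (q_of p n)^`() = n%:R *: p n.-1.
Proof.
by case: n => [|n] /=; [rewrite derivC scale0r|exact: laguerre_coherence Lpos La _ _].
Qed.

Lemma q_of_orthogonal n (T : {poly R}) : (size T <= n.-1)%N -> L (q_of p n * T) = 0.
Proof.
case: n => [|n] /= sT; first by rewrite mul1r (size_poly_leq0P _ sT) linear0.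
have [_ _ O1] := Op n.+1; have [_ _ O0] := Op n.
by rewrite mulrDl -scalerAl linearD linearZ /= O1 ?O0 ?mulr0 ?addr0// leqW.
Qed.

(** The derivative has degree one less, but it is a multiple of a true orthogonal polynomial; hence
    the same bound as for q_n itself. *)
Lemma q_of_deriv_orthogonal n (T : {poly R}) :
  (size T <= n.-1)%N -> L ((q_of p n)^`() * T) = 0.
Proof.
move=> sT; have [_ _ O] := Op n.-1.
by rewrite q_of_deriv -scalerAl linearZ /= O ?mulr0.
Qed.

End CoherentPolynomials.

Section GradientForm.
Context {R : realType} (a b N : R) (La Lb : {scalar {poly R}}).
Hypotheses (posA : positive_functional La) (posB : positive_functional Lb).
Hypothesis grad_ipE : forall f g, grad_ip a b f g =
  N * tensor_functional La Lb (dx f * dx g + dy f * dy g).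
Hypothesis N1 : N * tensor_functional La Lb 1 = 1.
Implicit Types (f g h : {poly {poly R}}) (c : R).

Local Notation ip := (grad_ip a b).

Lemma grad_ipC f g : ip f g = ip g f.
Proof. by rewrite !grad_ipE mulrC (mulrC (dy f)) mulrC (mulrC (dx f)). Qed.

Lemma grad_ipDl f g h : ip (f + g) h = ip f h + ip g h.
Proof.
rewrite !grad_ipE dxD dyD -[RHS]mulrDr -tensor_functionalD.
by congr (N * _); congr (tensor_functional La Lb _); ring.
Qed.

Lemma grad_ipZl c f g : ip (c%:P%:P * f) g = c * ip f g.
Proof.
rewrite !grad_ipE dxZ dyZ [RHS]mulrCA -(tensor_functionalZ La Lb c).
by congr (N * _); congr (tensor_functional La Lb _); ring.
Qed.

Lemma grad_ip_constl c f : ip c%:P%:P f = 0.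
Proof.
rewrite grad_ipE dx_const dy_const !mul0r addr0.
by rewrite /tensor_functional raddf0 linear0 mulr0.
Qed.

Lemma grad_ipNl f g : ip (- f) g = - ip f g.
Proof. by apply/eqP; rewrite -addr_eq0 -grad_ipDl addNr (grad_ip_constl 0). Qed.

Lemma grad_ip_suml (I : finType) (F : I -> {poly {poly R}}) g :
  ip (\sum_i F i) g = \sum_i ip (F i) g.
Proof.
apply: (big_morph (fun f => ip f g) (fun f h => grad_ipDl f h g)).
exact: (grad_ip_constl 0).
Qed.

Lemma grad_ip_eq0 f : ip f f = 0 -> f = (f`_0`_0)%:P%:P.
Proof.
have N0 : N != 0 by apply: contra_eqN N1 => /eqP ->; rewrite mul0r eq_sym oner_eq0.
rewrite grad_ipE tensor_functionalD => /eqP.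
rewrite mulf_eq0 (negbTE N0) /=.
have [x0 xE] := tensor_functional_sqr (dx f) posA posB.
have [y0 yE] := tensor_functional_sqr (dy f) posA posB.
by rewrite paddr_eq0// => /andP[/eqP/xE fx /eqP/yE fy]; apply: grad_eq0.
Qed.

Lemma grad_ip_eq_upto l f g h : h - (f + g) = l%:P%:P ->
  forall k, ip h k = ip f k + ip g k.
Proof.
by move=> /(canRL (subrK _)) -> k; rewrite !grad_ipDl grad_ip_constl add0r.
Qed.

Lemma grad_mx_tr m n (F : 'cV[{poly {poly R}}]_m) (G : 'cV[{poly {poly R}}]_n) :
  (grad_mx a b F G)^T = grad_mx a b G F.
Proof. by apply/matrixP => i j; rewrite !mxE grad_ipC. Qed.

Lemma grad_mx_eq_upto m n k (F F' : 'cV[{poly {poly R}}]_m)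
    (G : 'cV[{poly {poly R}}]_n) (K : 'cV[{poly {poly R}}]_k) (A : 'M[R]_(m, n)) :
  eq_upto_const F (F' + const_mx_poly A *m G) ->
  grad_mx a b F K = grad_mx a b F' K + A *m grad_mx a b G K.
Proof.
move=> FE; apply/matrixP => i j; have [c] := FE i; rewrite !mxE.
move=> /grad_ip_eq_upto -> ; congr (_ + _).
rewrite grad_ip_suml; apply: eq_bigr => l _.
by rewrite !mxE grad_ipZl.
Qed.

(** * Expansion of the Q_n in Sobolev polynomials and the matrix recursion *)

Section Recursion.
Context (pa pb : nat -> {poly R}).
Hypotheses (pearsonA : pearson a La) (pearsonB : pearson b Lb).
Hypothesis Opa : forall n, orthogonal_poly La n (pa n).
Hypothesis Opb : forall n, orthogonal_poly Lb n (pb n).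
Context (S_ : forall n, 'cV[{poly {poly R}}]_n.+1).
Hypothesis hS : forall (n : nat) (k : 'I_n.+1), (1 <= n)%N ->
  monic_sobolev_orthogonal a b n k (S_ n k 0).

Local Notation Q := (Qvec pa pb).
Local Notation C := (fun n : nat => grad_mx a b (Q n.+1) (Q n)).
Local Notation D := (fun n : nat => grad_mx a b (Q n) (Q n)).
Local Notation H := (fun n : nat => grad_mx a b (S_ n) (S_ n)).

Lemma Qvec_subr_monomial n (k : 'I_n.+1) :
  total_degree_le n.-1 (Q n k 0 - 'X^(n - k) * 'Y ^+ k).
Proof.
rewrite mxE -{1}(subnK (leq_ord k)).
have [qm sq] := q_of_monic Opa (n - k); have [qm' sq'] := q_of_monic Opb k.
exact: monic_tensor_subr_monomial.
Qed.

Lemma Qvec_subr_S n (k : 'I_n.+1) : (1 <= n)%N ->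
  total_degree_le n.-1 (Q n k 0 - S_ n k 0).
Proof.
move=> n1; have [Sk _] := hS k n1.
have := total_degree_leB (Qvec_subr_monomial k) Sk.
by rewrite opprB addrA subrK.
Qed.

Lemma Qvec_orthogonal n (k : 'I_n.+2) g :
  (1 <= n)%N -> total_degree_le n.-1 g -> ip (Q n.+1 k 0) g = 0.
Proof.
move=> n1 hg; rewrite grad_ipE mxE dx_tensor dy_tensor tensor_functionalD.
rewrite (@tensor_functional_orthogonal _ _ _ _ _ (n.+1 - k).-1 k.-1); first last.
(* Here i + j >= (n + 1 - k - 1) + (k - 1) = n - 1, and [dx] reads the coefficient at i + 1: total
   degree at least n, just beyond that of [g]. Truncation at k = 0 or k = n + 1 only raises the
   bound. *)
- by move=> i j hi hj; rewrite coef_dx hg ?mul0rn//; have := ltn_ord k; lia.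
- by move=> T; apply: q_of_orthogonal Opb _ _.
- by move=> T; apply: q_of_deriv_orthogonal posA pearsonA Opa _ _.
rewrite (@tensor_functional_orthogonal _ _ _ _ _ (n.+1 - k).-1 k.-1) ?addr0 ?mulr0//.
- by move=> T; apply: q_of_orthogonal Opa _ _.
- by move=> T; apply: q_of_deriv_orthogonal posB pearsonB Opb _ _.
- by move=> i j hi hj; rewrite coef_dy hg ?mul0rn//; have := ltn_ord k; lia.
Qed.

Lemma total_degree_top n f : (1 <= n)%N -> total_degree_le n f ->
  total_degree_le n.-1 (f - \sum_(k < n.+1) (f`_(n - k)`_k)%:P%:P * S_ n k 0).
Proof.
move=> n1 hf i j nij; rewrite !coefB !coef_sum.
have Sij (k : 'I_n.+1) : (S_ n k 0)`_i`_j = ((i == n - k)%N && (j == k))%:R.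
  have [/(_ i j nij) + _] := hS k n1.
  by rewrite !coefB coef_monomial2 => /eqP; rewrite subr_eq0 => /eqP.
under eq_bigr do rewrite coef_scale2 Sij.
have [ijn|ijn] := eqVneq (i + j)%N n; last first.
  have {}nij : (n < i + j)%N by lia.
  rewrite hf// big1 ?subrr// => k _.
  case: eqP => [ik|_]; case: eqP => [jk|_]; rewrite ?mulr0//.
  by exfalso; have := ltn_ord k; lia.
have jn : (j < n.+1)%N by lia.
rewrite (bigD1 (Ordinal jn)) //= big1 ?addr0.
  by rewrite -ijn addnK !eqxx mulr1 subrr.
move=> k kj; have /negbTE -> : j != k by rewrite eq_sym; exact: kj.
by rewrite andbF mulr0.
Qed.

(** Subtracting the monic S_k^n with the top coefficients of [f] leaves a polynomial of degree < n
    that is orthogonal to all such polynomials, hence to itself. *)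
Lemma sobolev_orthogonal_span n f : (1 <= n)%N -> total_degree_le n f ->
  (forall g, total_degree_le n.-1 g -> ip f g = 0) ->
  exists c, f - \sum_(k < n.+1) (f`_(n - k)`_k)%:P%:P * S_ n k 0 = c%:P%:P.
Proof.
move=> n1 hf fO; set g := (X in exists c, X = _); exists g`_0`_0.
have hg := total_degree_top n1 hf; rewrite -/g in hg.
apply: grad_ip_eq0; rewrite {1}/g grad_ipDl fO// add0r.
rewrite grad_ipNl grad_ip_suml big1 ?oppr0// => k _.
by have [_ SO] := hS k n1; rewrite grad_ipZl SO// mulr0.
Qed.

Lemma Qvec_expansion n : (1 <= n)%N ->
  exists A, eq_upto_const (Q n.+1) (S_ n.+1 + const_mx_poly A *m S_ n).
Proof.
move=> n1; pose f k := Q n.+1 k 0 - S_ n.+1 k 0.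
exists (\matrix_(i, j) (f i)`_(n - j)`_j) => i.
have fn := Qvec_subr_S i (ltn0Sn n).
have [g hg|c fE] := sobolev_orthogonal_span n1 fn.
  have gn : total_degree_le n g by apply: total_degree_leS hg; rewrite leq_pred.
  have [_ SO] := hS i (ltn0Sn n).
  rewrite grad_ipDl Qvec_orthogonal// add0r.
  by rewrite grad_ipNl SO// oppr0.
exists c; rewrite -fE [(_ + _ *m _) i 0]mxE opprD addrA; congr (_ - _).
by rewrite mxE; apply: eq_bigr => j _; rewrite /f mxE; congr (_%:P%:P * _); rewrite mxE.
Qed.

(** A vector v with v H = 0 gives a combination of the S_k^n of norm zero, hence a constant. Its
    coefficients in degree n >= 1 are the entries of v. *)
Lemma H_unitmx n : (1 <= n)%N -> H n \in unitmx.
Proof.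
move=> n1; rewrite -row_free_unit; apply/inj_row_free => v vH.
pose f := \sum_k (v 0 k)%:P%:P * S_ n k 0.
have fS k : ip f (S_ n k 0) = 0.
  have /matrixP/(_ 0 k) := vH; rewrite !mxE => vHk.
  rewrite grad_ip_suml -[RHS]vHk; apply: eq_bigr => j _.
  by rewrite grad_ipZl !mxE.
have /grad_ip_eq0 fc : ip f f = 0.
  rewrite {1}/f grad_ip_suml big1// => k _.
  by rewrite grad_ipZl grad_ipC fS mulr0.
apply/rowP => k; rewrite mxE.
have nk : (n.-1 < n - k + k)%N by rewrite subnK ?leq_ord// prednK.
have <- : f`_(n - k)`_k = v 0 k.
  rewrite /f !coef_sum (bigD1 k)//= big1 ?addr0.
    rewrite coef_scale2; have [/(_ _ _ nk) + _] := hS k n1.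
    by rewrite !coefB coef_monomial2 !eqxx => /eqP; rewrite subr_eq0 => /eqP ->;
      rewrite mulr1.
  move=> j jk; rewrite coef_scale2; have [/(_ _ _ nk) + _] := hS j n1.
  rewrite !coefB coef_monomial2 => /eqP; rewrite subr_eq0 => /eqP ->.
  by have /negbTE -> : (k : nat) != j; [rewrite eq_sym; exact: jk|rewrite andbF mulr0].
rewrite fc coef_const2 subnK ?leq_ord//.
by case: (n) n1.
Qed.

(** The gradients of S_0^1 and S_1^1 are the constant unit vectors, so only the total mass [N1] is
    evaluated. *)
Lemma H1 : H 1%N = 1%:M.
Proof.
have gradS (k : 'I_2) : dx (S_ 1%N k 0) = (k == 0)%:R%:P%:P /\
    dy (S_ 1%N k 0) = (k == 1)%:R%:P%:P.
  have [Sk _] := hS k (ltnSn 0).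
  have Sij i j : (0 < i + j)%N -> (S_ 1%N k 0)`_i`_j = ((i == 1 - k)%N && (j == k))%:R.
    move=> /Sk; rewrite !coefB coef_monomial2 => /eqP.
    by rewrite subr_eq0 => /eqP.
  split; apply: poly2P => i j; rewrite ?coef_dx ?coef_dy coef_const2 Sij ?addnS//.
    by case: k {Sk Sij} => [[|[|//]] ?]; case: i => [|[|i]]; case: j => [|j];
      rewrite ?subn0 ?subnn /= ?mul0rn ?mulr1n.
  by case: k {Sk Sij} => [[|[|//]] ?]; case: i => [|[|i]]; case: j => [|j];
      rewrite ?subn0 ?subnn /= ?mul0rn ?mulr1n.
apply/matrixP => i j; rewrite !mxE grad_ipE.
have [-> ->] := gradS i; have [-> ->] := gradS j.
rewrite -!polyCM -!polyCD -[X in tensor_functional _ _ X]mulr1 tensor_functionalZ mulrCA.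
rewrite N1 mulr1.
by case: i j => [[|[|//]] ?] [[|[|//]] ?]; rewrite /= ?mulr0 ?mul0r ?mulr1 ?addr0 ?add0r.
Qed.

Lemma S_orthogonal n : (1 <= n)%N -> grad_mx a b (S_ n.+1) (S_ n) = 0.
Proof.
move=> n1; apply/matrixP => i j; rewrite !mxE.
have [_ SO] := hS i (ltn0Sn n); apply: SO => /= k l nkl.
have [/(_ k l) + _] := hS j n1; rewrite (leq_ltn_trans (leq_pred n))//.
move=> /(_ isT); rewrite !coefB coef_monomial2 => /eqP; rewrite subr_eq0 => /eqP ->.
case: eqP => [kE|//]; case: eqP => [lE|//].
by exfalso; have := ltn_ord j; lia.
Qed.

Lemma grad_mx_S_Q n : (1 <= n)%N -> grad_mx a b (S_ n) (Q n) = H n.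
Proof.
move=> n1; apply/matrixP => i j; rewrite !mxE -[X in ip _ X](subrK (S_ n j 0)).
have [_ SO] := hS i n1.
by rewrite grad_ipC grad_ipDl grad_ipC SO ?add0r 1?grad_ipC//;
  have := Qvec_subr_S j n1; rewrite mxE.
Qed.

Lemma grad_mx_S_QS n : (1 <= n)%N -> grad_mx a b (S_ n.+1) (Q n) = 0.
Proof.
move=> n1; apply/matrixP => i j; rewrite !mxE.
have [_ SO] := hS i (ltn0Sn n); apply: SO => /= k l nkl.
have := Qvec_subr_monomial j; rewrite mxE => /(_ k l).
rewrite (leq_ltn_trans (leq_pred n))// => /(_ isT).
rewrite !coefB coef_monomial2 => /eqP; rewrite subr_eq0 => /eqP ->.
case: eqP => [kE|//]; case: eqP => [lE|//].
by exfalso; have := ltn_ord j; lia.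
Qed.

Lemma sobolev_recursion :
  [/\ forall n : nat, (1 <= n)%N -> H n \in unitmx,
      H 1%N = 1%:M,
      forall n : nat, (1 <= n)%N ->
        H n.+1 = D n.+1 - C n *m invmx (H n) *m (C n)^T
    & forall n : nat, (1 <= n)%N -> forall A : 'M[R]_(n.+2, n.+1),
        eq_upto_const (Q n.+1) (S_ n.+1 + const_mx_poly A *m S_ n)
        <-> A = C n *m invmx (H n)].
Proof.
have CE n A : (1 <= n)%N ->
    eq_upto_const (Q n.+1) (S_ n.+1 + const_mx_poly A *m S_ n) ->
    C n = A *m H n.
  by move=> n1 /grad_mx_eq_upto ->; rewrite grad_mx_S_QS// grad_mx_S_Q// add0r.
split; [exact: H_unitmx|exact: H1| |].
(* With C = A H the subtracted term is A (A H)^T, and expanding both factors of D_(n+1) produces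
   H_(n+1) plus that same term. *)
- move=> n n1; have [A QA] := Qvec_expansion n1.
  rewrite (CE _ _ n1 QA) mulmxK ?H_unitmx// (grad_mx_eq_upto _ QA) grad_mx_S_Q//.
  rewrite -(grad_mx_tr _ (S_ n)) (grad_mx_eq_upto _ QA) S_orthogonal// add0r.
  by rewrite addrK.
- move=> n n1 A; split=> [QA|->].
    by rewrite (CE _ _ n1 QA) mulmxK// H_unitmx.
  (* Some expansion exists, and pairing with Q_n forces its matrix to be C H^-1. *)
  have [B QB] := Qvec_expansion n1.
  by rewrite (CE _ _ n1 QB) mulmxK// H_unitmx.
Qed.

End Recursion.
End GradientForm.

(** * Integrals over the half-line *)

Section HalfLine.
Context {R : realType}.
Implicit Types (f F g G : R -> R) (b x l : R).
Local Notation mu := (@lebesgue_measure R).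

(** The integrand may blow up at 0, where [F] is only asked to have a limit. The sets [1/(n+1),
    +oo[ exhaust ]0, +oo[, and monotone convergence, which uses f >= 0, passes to the limit. *)
Lemma ge0_FTC_0y f F l0 l :
  (forall x, 0 < x -> 0 <= f x) ->
  (forall x, 0 < x -> {for x, continuous f}) ->
  (forall x, 0 < x -> is_derive x 1 F (f x)) ->
  F x @[x --> 0^'+] --> l0 -> F x @[x --> +oo] --> l ->
  (\int[mu]_(x in `]0%R, +oo[) (f x)%:E = (l - l0)%:E)%E.
Proof.
move=> f0 fc dF Fl0 Fl.
pose D (n : nat) : set R := `[n.+1%:R^-1, +oo[%classic.
have n0 (n : nat) : 0 < n.+1%:R^-1 :> R by rewrite invr_gt0.
have DU : `]0, +oo[%classic = \bigcup_n D n.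
  apply/seteqP; split=> [x /=|x [n _]]; rewrite /D /= !in_itv/= !andbT;
    last exact: lt_le_trans (n0 n).
  move=> x0; have [n _ nx] := near_infty_natSinv_lt (PosNum x0).
  by exists n => //=; rewrite in_itv/= andbT ltW// nx/=.
have mf : measurable_fun (`]0, +oo[%classic : set R) f.
  apply: open_continuous_measurable_fun => // x; rewrite inE/= in_itv/= andbT.
  exact: fc.
have subD (n : nat) : D n `<=` `]0, +oo[%classic by move=> x Dx; rewrite DU; exists n.
have DI (n : nat) : (\int[mu]_(x in D n) (f x)%:E = (l - F n.+1%:R^-1)%:E)%E.
  rewrite EFinB; apply: ge0_continuous_FTC2y => //.
  - by move=> x nx; apply/f0/(lt_le_trans _ nx).
  - by apply: continuous_in_subspaceT => x /set_mem/subD;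
      rewrite /= in_itv/= andbT => /fc.
  - by move=> x nx; have [] := dF x (lt_trans (n0 n) nx).
  - apply: cvg_at_right_filter; apply/differentiable_continuous/derivable1_diffP.
    by have [] := dF _ (n0 n).
  - move=> x; rewrite in_itv/= andbT => nx; rewrite derive1E.
    by have [] := dF x (lt_trans (n0 n) nx).
have cvgI : (\int[mu]_(x in D n) (f x)%:E @[n --> \oo]
    --> \int[mu]_(x in `]0%R, +oo[) (f x)%:E)%E.
  rewrite DU; apply: ge0_nondecreasing_set_cvg_integral.
  - move=> m n mn; apply/subsetPset => x; rewrite /D /= !in_itv/= !andbT.
    by apply: le_trans; rewrite lef_pV2 ?posrE// ler_nat.
  - by move=> n; exact: measurable_itv.
  - by move=> n; apply/measurable_EFinP; exact: measurable_funS mf.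
  - by move=> n x /subD; rewrite /= in_itv/= andbT lee_fin => /f0.
apply: cvg_unique cvgI _ => //=.
under eq_cvg do rewrite DI.
apply: cvg_EFin; first exact: nearW.
apply: cvgB; first exact: cvg_cst.
have /cvg_at_rightP := Fl0; apply; split => //.
exact: cvg_harmonic.
Qed.

Lemma is_derive_powR c x : 0 < x ->
  is_derive x (1 : R) (fun x => x `^ c) (c * x `^ (c - 1)).
Proof.
move=> x0; have x0' : x \in `]0, +oo[%R by rewrite in_itv/= x0.
apply: DeriveDef; first exact: derivable_powR.
by rewrite -derive1E powR_derive1.
Qed.

Lemma cvg_powR_expRN_y c : x `^ c * expR (- x) @[x --> +oo] --> (0 : R).
Proof.
pose n := Num.bound `|c|.
have cn : c <= n%:R by rewrite (le_trans (ler_norm c))// ltW// archi_boundP.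
(* For x >= 1 and c <= n: x^c x <= x^(n+1) <= (n+1)! e^x. *)
apply: (@squeeze_cvgr _ _ _ _ (fun=> 0) (fun x => (n.+1)`!%:R * x^-1)).
- near=> x; have x1 : 1 <= x by near: x; exact: nbhs_pinfty_ge.
  have x0 : 0 < x by rewrite (lt_le_trans _ x1).
  rewrite mulr_ge0 ?powR_ge0 ?expR_ge0//= expRN.
  rewrite ler_pdivrMr ?expR_gt0// mulrAC ler_pdivlMr//.
  rewrite (@le_trans _ _ (x ^+ n.+1))//.
    by rewrite exprSr ler_pM2r// -(powR_mulrn _ (ltW x0)) ler_powR.
  rewrite [leRHS]mulrC -ler_pdivrMr ?ltr0n ?fact_gt0//.
  by have := expR_ge1Dxn n (ltW x0); lra.
- exact: cvg_cst.
- rewrite -[X in _ --> X](mulr0 (n.+1)`!%:R); apply: cvgM; first exact: cvg_cst.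
  apply/gtr0_cvgV0; last exact: cvg_id.
  by near=> x; near: x; exact: nbhs_pinfty_gt.
Unshelve. all: by end_near. Qed.

Lemma cvg_powR_expRN_0 c : 0 < c -> x `^ c * expR (- x) @[x --> (0 : R)^'+] --> (0 : R).
Proof.
move=> c0; rewrite -[X in _ --> X](mul0r (expR (- 0))).
apply: cvgM; first exact: powR_cvg0.
apply: cvg_at_right_filter; apply: continuous_comp; last exact: continuous_expR.
exact: opp_continuous.
Qed.

Lemma is_derive_expRN x : is_derive x (1 : R) (fun x => expR (- x)) (- expR (- x)).
Proof.
have -> : - expR (- x) = expR (- x) * (- 1) by rewrite mulrN1.
exact: (@is_derive1_comp _ expR (fun x => - x)).
Qed.

Lemma is_derive_powR_expRN c x : 0 < x ->
  is_derive x (1 : R) (fun x => x `^ c * expR (- x))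
    (c * x `^ (c - 1) * expR (- x) - x `^ c * expR (- x)).
Proof.
move=> x0; have d1 := is_derive_powR c x0; have d2 := is_derive_expRN x.
apply: is_derive_eq; rewrite /GRing.scale/=; ring.
Qed.

Lemma continuous_powR_expRN c x : 0 < x ->
  {for x, continuous (fun x => x `^ c * expR (- x))}.
Proof.
move=> x0; apply/differentiable_continuous/derivable1_diffP.
by have [] := is_derive_powR_expRN c x0.
Qed.

Lemma continuous_expRN : continuous (fun x : R => expR (- x)).
Proof.
move=> x; apply/differentiable_continuous/derivable1_diffP.
by have [] := is_derive_expRN x.
Qed.

(* For b <= 1 take G = (1 - e^-x)^b / b, as 1 - e^-x <= x; if G' dominates for b
   then (b G - x^b e^-x)' dominates for b + 1. *)
Lemma powR_expRN_dominated b : 0 < b -> exists G g l0 l,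
  [/\ forall x, 0 < x -> is_derive x 1 G (g x),
      forall x, 0 < x -> {for x, continuous g},
      G x @[x --> (0 : R)^'+] --> (l0 : R), G x @[x --> +oo] --> (l : R) &
      forall x, 0 < x -> x `^ (b - 1) * expR (- x) <= g x].
Proof.
(* The induction runs on an integer bound, [b] being real. *)
move=> b0; have [n] : exists n : nat, b <= n.+1%:R.
  exists (Num.bound b); rewrite ltW// (lt_le_trans (archi_boundP (ltW b0)))//.
  by rewrite ler_nat.
elim: n b b0 => [|n IHn] b b0 bn.
  pose u (x : R) := 1 - expR (- x).
  have u0 x : 0 < x -> 0 < u x by move=> x0; rewrite subr_gt0 expR_lt1 oppr_lt0.
  have ux x : u x <= x by have := expR_ge1Dx (- x); rewrite /u; lra.
  have du x : is_derive x (1 : R) u (expR (- x)).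
    have := is_derive_expRN x => d; apply: is_derive_eq; ring.
  exists (fun x => u x `^ b / b), (fun x => u x `^ (b - 1) * expR (- x)), 0, b^-1.
  split.
  - move=> x x0; have d := is_derive_powR b (u0 x x0).
    have d' := @is_derive1_comp _ (fun y => y `^ b) u x _ _ d (du x).
    have -> : (fun x => u x `^ b / b) = b^-1 *: ((fun y => y `^ b) \o u).
      by apply/funext => y; rewrite /GRing.scale/= mulrC.
    apply: is_derive_eq; rewrite /GRing.scale/= !mulrA mulVf ?mul1r//; exact: lt0r_neq0.
  - move=> x x0; apply: cvgM.
      have : {for x, continuous ((fun y => y `^ (b - 1)) \o u)}; last by [].
      apply: continuous_comp; apply/differentiable_continuous/derivable1_diffP.
        by have [] := du x.
      by have [] := is_derive_powR (b - 1) (u0 x x0).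
    exact: continuous_expRN.
  - rewrite -[X in _ --> X](mul0r b^-1); apply: cvgM; last exact: cvg_cst.
    apply: (@squeeze_cvgr _ _ _ _ (fun=> 0) (fun x => x `^ b)).
    + near=> x; have x0 : 0 < x by near: x; exact: nbhs_right_gt.
      rewrite powR_ge0/=; apply: (ge0_ler_powR (ltW b0)); [| |exact: ux].
        by rewrite nnegrE ltW// u0.
      by rewrite nnegrE ltW.
    + exact: cvg_cst.
    + exact: powR_cvg0.
  - rewrite -[X in _ --> X]mul1r; apply: cvgM; last exact: cvg_cst.
    have u1 : u x @[x --> +oo] --> (1 : R).
      by rewrite -[X in _ --> X]subr0; apply: cvgB; [exact: cvg_cst|exact: cvgr_expR].
    have pc : {for 1, continuous (fun y : R => y `^ b)}.
      apply/differentiable_continuous/derivable1_diffP.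
      by have [] := is_derive_powR b ltr01.
    by have := cvg_comp _ _ u1 pc; rewrite powR1.
  (* The exponent b - 1 <= 0 reverses 1 - e^-x <= x. *)
  - move=> x x0; rewrite ler_pM2r ?expR_gt0// -(opprB 1 b) !powRN.
    rewrite lef_pV2 ?posrE ?powR_gt0 ?u0//.
    have b1 : 0 <= 1 - b by rewrite subr_ge0.
    apply: (ge0_ler_powR b1); [| |exact: ux].
      by rewrite nnegrE ltW// u0.
    by rewrite nnegrE ltW.
have [b1|b1] := leP b 1; first by apply: IHn => //; rewrite (le_trans b1)// ler1n.
have [||G [g [l0 [l [dG gc Gl0 Gl gE]]]]] := IHn (b - 1).
  by rewrite subr_gt0.
  by move: bn; rewrite -natr1; lra.
exists (fun x => (b - 1) * G x - x `^ (b - 1) * expR (- x)).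
exists (fun x => (b - 1) * g x -
  ((b - 1) * x `^ (b - 1 - 1) * expR (- x) - x `^ (b - 1) * expR (- x))).
exists ((b - 1) * l0), ((b - 1) * l); split.
- move=> x x0; have d1 := dG x x0; have d2 := is_derive_powR_expRN (b - 1) x0.
  exact: is_derive_eq.
- move=> x x0; apply: cvgB; first by apply: cvgM; [exact: cvg_cst|exact: gc].
  apply: cvgB; last exact: continuous_powR_expRN.
  under eq_cvg do rewrite -mulrA. rewrite -mulrA.
  by apply: cvgM; [exact: cvg_cst|exact: continuous_powR_expRN].
- rewrite -[(b - 1) * l0]subr0; apply: cvgB;
    last by apply: cvg_powR_expRN_0; rewrite subr_gt0.
  by apply: cvgM; [exact: cvg_cst|].
- rewrite -[(b - 1) * l]subr0; apply: cvgB; last exact: cvg_powR_expRN_y.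
  by apply: cvgM; [exact: cvg_cst|].
(* The new derivative exceeds x^(b-1) e^-x by (b - 1) (g - x^(b-2) e^-x). *)
- move=> x x0; rewrite opprB addrCA lerDl subr_ge0 -mulrA ler_pM2l ?subr_gt0//.
  exact: gE.
Unshelve. all: by end_near. Qed.

End HalfLine.

(** * Linear combinations and products of integrable functions *)

Section Rintegral_extra.
Context d (T : measurableType d) {R : realType} (mu : {measure set T -> \bar R}).

Lemma Rintegral_lincomb (D : set T) (I : Type) (s : seq I)
    (c : I -> R) (h : I -> T -> R) :
  measurable D -> (forall i, mu.-integrable D (EFin \o h i)) ->
  mu.-integrable D (EFin \o (fun x => \sum_(i <- s) c i * h i x)) /\
  \int[mu]_(x in D) (\sum_(i <- s) c i * h i x)
  = \sum_(i <- s) c i * \int[mu]_(x in D) h i x.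
Proof.
move=> mD ih; elim: s => [|i s [IHi IHs]].
  split; last by under eq_Rintegral do rewrite big_nil;
    rewrite Rintegral_cst// big_nil mul0r.
  by under eq_fun do rewrite big_nil; exact: integrable0.
have ii : mu.-integrable D (EFin \o (fun x => c i * h i x)).
  by have := integrableZl mD (c i) (ih i).
split.
  under eq_fun do rewrite big_cons.
  have := integrableD mD ii IHi; apply: eq_integrable => // x _.
under eq_Rintegral do rewrite big_cons.
by rewrite RintegralD// RintegralZl// IHs big_cons.
Qed.

End Rintegral_extra.

Section ProductIntegral.
Context d1 d2 (T1 : measurableType d1) (T2 : measurableType d2) {R : realType}.
Context (m1 : {sigma_finite_measure set T1 -> \bar R}).
Context (m2 : {sigma_finite_measure set T2 -> \bar R}).

(** Extension by zero turns the rectangle into the whole product space. There Tonelli gives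
    integrability, the iterated integral of |F G| being a product of two finite ones, and Fubini
    then gives the value. *)
Lemma Rintegral_prod (D1 : set T1) (D2 : set T2) (f : T1 -> R) (g : T2 -> R) :
  measurable D1 -> measurable D2 ->
  m1.-integrable D1 (EFin \o f) -> m2.-integrable D2 (EFin \o g) ->
  (m1 \x m2)%E.-integrable (D1 `*` D2) (EFin \o (fun z => f z.1 * g z.2)) /\
  \int[(m1 \x m2)%E]_(z in D1 `*` D2) (f z.1 * g z.2)
  = \int[m1]_(x in D1) f x * \int[m2]_(y in D2) g y.
Proof.
move=> mD1 mD2 fi gi.
pose F : T1 -> R := f \_ D1; pose G : T2 -> R := g \_ D2.
pose K (z : T1 * T2) : R := F z.1 * G z.2.
have Fi : m1.-integrable setT (EFin \o F).
  by rewrite /F -restrict_EFin; apply/integrable_restrict => //; rewrite setTI.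
have Gi : m2.-integrable setT (EFin \o G).
  by rewrite /G -restrict_EFin; apply/integrable_restrict => //; rewrite setTI.
have FGE : (fun z => f z.1 * g z.2) \_ (D1 `*` D2) = K.
  apply/funext => -[x y]; rewrite /K /F /G !patchE in_setX /=.
  by case: (x \in D1) => /=; case: (y \in D2); rewrite ?mulr0 ?mul0r.
have mF : measurable_fun setT F by apply/measurable_EFinP; have /integrableP[] := Fi.
have mG : measurable_fun setT G by apply/measurable_EFinP; have /integrableP[] := Gi.
have mFG : measurable_fun setT K.
  by apply: measurable_funM; apply: measurableT_comp.
have maF : measurable_fun setT (fun x => `|F x|%:E).
  exact/measurable_EFinP/measurableT_comp.
have maG : measurable_fun setT (fun y => `|(G y)%:E|%E).
  exact: (measurableT_comp _ (proj1 (integrableP _ _ _ Gi))).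
have FGi : (m1 \x m2)%E.-integrable setT (EFin \o K).
  apply/integrable12ltyP; first exact/measurable_EFinP.
  have -> : (fun x => \int[m2]_y `|(EFin \o K) (x, y)|)%E
      = (fun x => `|F x|%:E * \int[m2]_y `|(G y)%:E|)%E.
    apply/funext => x; rewrite -ge0_integralZl//.
    by apply: eq_integral => y _; rewrite /= normrM EFinM.
  have /integrableP[_ Foo] := Fi; have /integrableP[_ Goo] := Gi.
  rewrite ge0_integralZr//; last exact: integral_ge0.
  by rewrite lte_mul_pinfty// ?integral_ge0// ge0_fin_numE// integral_ge0.
split.
  have := FGi; rewrite -FGE -restrict_EFin => /integrable_restrict; rewrite setTI.
  by apply => //; exact: measurableX.
rewrite /Rintegral [in LHS]integral_mkcond [X in _ = fine X * _]integral_mkcond.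
rewrite [X in _ = _ * fine X]integral_mkcond !restrict_EFin FGE.
rewrite -integral12_prod_meas1//.
have Gf : (\int[m2]_y (EFin \o G) y)%E \is a fin_num by exact: integrable_fin_num.
have Ff : (\int[m1]_x (EFin \o F) x)%E \is a fin_num by exact: integrable_fin_num.
rewrite -fineM//; congr fine.
rewrite -(fineK Gf) -integralZr//; apply: eq_integral => x _.
rewrite fineK// -integralZl//.
Qed.

End ProductIntegral.

(** * The Gamma integral and its functional equation *)

Section GammaIntegral.
Context {R : realType}.
Implicit Types (b x : R).
Local Notation mu := (@lebesgue_measure R).
Local Notation h b := (fun x : R => x `^ (b - 1) * expR (- x)).

Lemma measurable_powR_expRN (D : set R) c :
  measurable_fun D (fun x : R => x `^ c * expR (- x)).
Proof.
apply: (@measurable_funS _ _ _ _ setT) => //.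
apply: measurable_funM; first exact: measurable_powR.
exact: continuous_measurable_fun continuous_expRN.
Qed.

Lemma powR_expRN_ge0 c x : 0 <= x `^ c * expR (- x).
Proof. by rewrite mulr_ge0 ?powR_ge0 ?expR_ge0. Qed.

Lemma powR_expRN_integrable_majorant b : 0 < b -> exists G g l0 l,
  [/\ (forall x, 0 < x -> is_derive x 1 G (g x)) /\
      (forall x, 0 < x -> {for x, continuous g}),
      G x @[x --> (0 : R)^'+] --> (l0 : R), G x @[x --> +oo] --> (l : R),
      (forall x, 0 < x -> x `^ (b - 1) * expR (- x) <= g x) &
      mu.-integrable `]0, +oo[%classic (EFin \o g) /\
      \int[mu]_(x in `]0, +oo[%classic) g x = l - l0].
Proof.
move=> b0; have [G [g [l0 [l [dG gc Gl0 Gl hg]]]]] := powR_expRN_dominated b0.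
have g0 x : 0 < x -> 0 <= g x
  by move=> x0; exact: le_trans (powR_expRN_ge0 _ _) (hg x x0).
have gE := ge0_FTC_0y g0 gc dG Gl0 Gl.
have mg : measurable_fun (`]0, +oo[%classic : set R) g.
  apply: open_continuous_measurable_fun => // x; rewrite inE/= in_itv/= andbT.
  exact: gc.
exists G, g, l0, l; split=> //; split; last by rewrite /Rintegral gE.
apply/integrableP; split; first exact/measurable_EFinP.
have -> : (\int[mu]_(x in `]0%R, +oo[) `|(EFin \o g) x| = (l - l0)%:E)%E.
  rewrite -gE; apply: eq_integral => x; rewrite inE/= in_itv/= andbT => x0.
  by rewrite ger0_norm ?g0.
exact: ltry.
Qed.

Lemma integrable_powR_expRN_oo b : 0 < b ->
  mu.-integrable `]0, +oo[%classic (EFin \o h b).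
Proof.
move=> /powR_expRN_integrable_majorant[G [g [l0 [l [_ _ _ hg [gi _]]]]]].
have mh : measurable_fun (`]0, +oo[%classic : set R) (EFin \o h b).
  apply/measurable_EFinP. exact: measurable_powR_expRN.
apply: le_integrable gi; [by []|exact: mh|].
move=> x; rewrite /= in_itv/= andbT => x0; rewrite lee_fin/=.
by rewrite ger0_norm ?powR_expRN_ge0// (le_trans (hg x x0))// ler_norm.
Qed.

Lemma integrable_powR_expRN b : 0 < b ->
  mu.-integrable `[0, +oo[%classic (EFin \o h b).
Proof.
move=> b0.
have mh : measurable_fun (`[0, +oo[%classic : set R) (EFin \o h b).
  by apply/measurable_EFinP; exact: measurable_powR_expRN.
have E := @negligible_integrable _ _ R mu `[0, +oo[%classic [set 0] (EFin \o h b)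
  (measurable_set1 _) (measurable_itv _) mh (lebesgue_measure_set1 _).
apply/E; rewrite setDitv1l; exact: integrable_powR_expRN_oo.
Qed.

(** Integration by parts of x^b e^-x, whose derivative changes sign. Passing to b G - x^b e^-x, with
    G' = g a majorant of x^(b-1) e^-x, makes the derivative nonnegative, so that [ge0_FTC_0y]
    applies; the contribution of G cancels at the end. *)
Lemma Rintegral_powR_expRN_rec b : 0 < b ->
  \int[mu]_(x in `[0, +oo[%classic) h (b + 1) x
  = b * \int[mu]_(x in `[0, +oo[%classic) h b x.
Proof.
move=> b0; have [G [g [l0 [l [[dG gc] Gl0 Gl hg [gi gE]]]]]] :=
  powR_expRN_integrable_majorant b0.
have b10 : 0 < b + 1 by rewrite addr_gt0.
have hi := integrable_powR_expRN_oo b0; have hi1 := integrable_powR_expRN_oo b10.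
rewrite -!Rintegral_itv_obnd_cbnd//.
have dF x : 0 < x -> is_derive x 1 (fun x => b * G x - x `^ b * expR (- x))
    (b * g x - (b * x `^ (b - 1) * expR (- x) - x `^ b * expR (- x))).
  move=> x0; have d1 := dG x x0; have d2 := is_derive_powR_expRN b x0.
  exact: is_derive_eq.
have f10 x : 0 < x ->
    0 <= b * g x - (b * x `^ (b - 1) * expR (- x) - x `^ b * expR (- x)).
  move=> x0; have := powR_expRN_ge0 b x; have := hg x x0.
  by rewrite -(ler_pM2l b0) mulrA; lra.
have f1c x : 0 < x -> {for x, continuous
    (fun x => b * g x - (b * x `^ (b - 1) * expR (- x) - x `^ b * expR (- x)))}.
  move=> x0; apply: cvgB; first by apply: cvgM; [exact: cvg_cst|exact: gc].
  apply: cvgB; last exact: continuous_powR_expRN.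
  under eq_cvg do rewrite -mulrA. rewrite -mulrA.
  by apply: cvgM; [exact: cvg_cst|exact: continuous_powR_expRN].
have F0 : (b * G x - x `^ b * expR (- x)) @[x --> (0 : R)^'+] --> b * l0 - 0.
  by apply: cvgB; [apply: cvgM => //; exact: cvg_cst|exact: cvg_powR_expRN_0].
have Foo : (b * G x - x `^ b * expR (- x)) @[x --> +oo] --> b * l - 0.
  by apply: cvgB; [apply: cvgM => //; exact: cvg_cst|exact: cvg_powR_expRN_y].
have := congr1 fine (ge0_FTC_0y f10 f1c dF F0 Foo).
rewrite -/(Rintegral _ _ _) /=.
under eq_Rintegral do rewrite -mulrA.
have hbi : mu.-integrable `]0, +oo[%classic (EFin \o (fun x => b * h b x)).
  exact: (integrableZl _ b hi).
have gbi : mu.-integrable `]0, +oo[%classic (EFin \o (fun x => b * g x)).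
  exact: (integrableZl _ b gi).
have hb1i : mu.-integrable `]0, +oo[%classic (EFin \o (fun x => x `^ b * expR (- x))).
  by apply: eq_integrable hi1 => // x _; rewrite /= addrK.
rewrite RintegralB//; last exact: (integrableB _ hbi hb1i).
rewrite RintegralB// !RintegralZl// gE.
have -> : \int[mu]_(x in `]0, +oo[%classic) h (b + 1) x
    = \int[mu]_(x in `]0, +oo[%classic) (x `^ b * expR (- x)).
  by apply: eq_Rintegral => x _; rewrite addrK.
lra.
Qed.

End GammaIntegral.

(** * The Laguerre functional, its Pearson identity and its positivity *)

Section LaguerreFunctional.
Context {R : realType}.
Implicit Types (a x : R) (P : {poly R}).
Local Notation mu := (@lebesgue_measure R).

Definition laguerre_moment a n : R :=
  \int[mu]_(x in `[0, +oo[%classic) (x ^+ n * laguerre_weight a x).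

(** Built from the moments rather than as an integral: it is then linear for every [a], and the
    linear structure can be declared without a > -1 or integrability. [laguerre_functionalE]
    recovers the integral. *)
Definition laguerre_functional a P : R := \sum_(i < size P) P`_i * laguerre_moment a i.

Lemma laguerre_functional_wide a n P : (size P <= n)%N ->
  laguerre_functional a P = \sum_(i < n) P`_i * laguerre_moment a i.
Proof.
move=> sP; rewrite /laguerre_functional (big_ord_widen _
  (fun i => P`_i * laguerre_moment a i) sP).
rewrite big_mkcond; apply: eq_bigr => i _; case: ltnP => // Pi.
by rewrite nth_default ?mul0r.
Qed.

Lemma laguerre_functional_is_scalar a : scalar (laguerre_functional a).
Proof.
move=> c P Q; set n := maxn (size P) (size Q).
rewrite (@laguerre_functional_wide a n P) ?leq_maxl//.
rewrite (@laguerre_functional_wide a n Q) ?leq_maxr//.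
rewrite (@laguerre_functional_wide a n); last first.
  rewrite (leq_trans (size_polyD _ _))// geq_max leq_maxr andbT.
  by rewrite (leq_trans (size_scale_leq _ _))// leq_maxl.
rewrite mulr_sumr -big_split /=; apply: eq_bigr => i _.
by rewrite coefD coefZ mulrDl mulrA.
Qed.

HB.instance Definition _ a := GRing.isLinear.Build R {poly R} R _
  (laguerre_functional a) (laguerre_functional_is_scalar a).

Lemma laguerre_weightX a n x : -1 < a -> 0 <= x ->
  x ^+ n * laguerre_weight a x = x `^ (a + n%:R) * expR (- x).
Proof.
move=> a1 x0; rewrite /laguerre_weight mulrA; congr (_ * _).
case: n => [|n]; first by rewrite expr0 mul1r addr0.
(* At x = 0 the power is 0 only for a nonzero exponent, since 0 to the power 0 is 1. *)
have an : a + n.+1%:R != 0 by rewrite gt_eqF// -natr1; have := ler0n R n; lra.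
have [->|xN0] := eqVneq x 0; first by rewrite expr0n mul0r powR0.
by rewrite powRD ?xN0 ?implybT// powR_mulrn// mulrC.
Qed.

Lemma laguerre_weight_ge0 a x : 0 <= laguerre_weight a x.
Proof. exact: powR_expRN_ge0. Qed.

Lemma laguerre_weight_gt0 a x : 0 < x -> 0 < laguerre_weight a x.
Proof. by move=> x0; rewrite mulr_gt0 ?powR_gt0 ?expR_gt0. Qed.

Lemma laguerre_momentE a n : -1 < a -> laguerre_moment a n
  = \int[mu]_(x in `[0, +oo[%classic) (x `^ (a + 1 + n%:R - 1) * expR (- x)).
Proof.
move=> a1; apply: eq_Rintegral => x; rewrite inE/= in_itv/= andbT => x0.
by rewrite laguerre_weightX//; congr (_ `^ _ * _); ring.
Qed.

Lemma integrable_laguerre a n : -1 < a ->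
  mu.-integrable `[0, +oo[%classic (EFin \o (fun x => x ^+ n * laguerre_weight a x)).
Proof.
move=> a1; have b0 : 0 < a + 1 + n%:R by have := ler0n R n; lra.
apply: eq_integrable (integrable_powR_expRN b0) => // x.
rewrite inE/= in_itv/= andbT => x0.
by rewrite laguerre_weightX//; congr (_ `^ _ * _)%:E; ring.
Qed.

Lemma laguerre_moment_rec a n : -1 < a ->
  laguerre_moment a n.+1 = (a + 1 + n%:R) * laguerre_moment a n.
Proof.
move=> a1; have b0 : 0 < a + 1 + n%:R by have := ler0n R n; lra.
by rewrite !laguerre_momentE// -Rintegral_powR_expRN_rec// -natr1 addrA.
Qed.

Lemma laguerre_functionalE a P : -1 < a ->
  mu.-integrable `[0, +oo[%classic (EFin \o (fun x => P.[x] * laguerre_weight a x)) /\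
  laguerre_functional a P
  = \int[mu]_(x in `[0, +oo[%classic) (P.[x] * laguerre_weight a x).
Proof.
move=> a1; have PE : (fun x => P.[x] * laguerre_weight a x)
    = (fun x => \sum_(i < size P) P`_i * (x ^+ i * laguerre_weight a x)).
  by apply/funext => x; rewrite horner_coef mulr_suml;
    apply: eq_bigr => i _; rewrite -mulrA.
have [Pi PI] := @Rintegral_lincomb _ _ R mu `[0, +oo[%classic _ (index_enum 'I_(size P))
  (fun i => P`_i) _ (measurable_itv _) (fun i : 'I_(size P) => integrable_laguerre i a1).
by rewrite PE PI.
Qed.

(** On x^i, with moments m_i, both sides equal i m_i because m_(i+1) = (a + 1 + i) m_i; the
    integration by parts sits in that recursion. *)
Lemma pearson_laguerre a : -1 < a -> pearson a (laguerre_functional a).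
Proof.
move=> a1 P; rewrite [in RHS]mulrBl linearB /=.
have shift (Q : {poly R}) n : (size Q <= n)%N ->
    laguerre_functional a ('X * Q) = \sum_(i < n) Q`_i * laguerre_moment a i.+1.
  move=> sQ; rewrite (@laguerre_functional_wide a n.+1); last first.
    apply/leq_sizeP => -[//|k] nk; rewrite coefXM/= nth_default//.
    exact: leq_trans sQ _.
  rewrite big_ord_recl coefXM mul0r add0r; apply: eq_bigr => i _.
  by rewrite coefXM.
have [n sP] : exists n, (size P <= n.+1)%N by exists (size P).
rewrite (@shift P n.+1)// (@shift P^`() n.+1); last first.
  by rewrite (leq_trans (size_poly _ _))// (leq_trans (leq_pred _)).
rewrite mul_polyC linearZ/= (laguerre_functional_wide _ sP) mulr_sumr -sumrB.
rewrite big_ord_recr/= coef_deriv nth_default// mul0rn mul0r addr0.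
rewrite big_ord_recl/= laguerre_moment_rec// addr0 mulrCA subrr add0r.
apply: eq_bigr => i _; rewrite coef_deriv /bump/= add1n (laguerre_moment_rec i.+1 a1).
by rewrite -[P`_i.+1 *+ _]mulr_natr; ring.
Qed.

Lemma positive_functional_laguerre a : -1 < a ->
  positive_functional (laguerre_functional a).
Proof.
move=> a1 P P0; have [Pi PE] := laguerre_functionalE P a1.
have Pw0 x : 0 <= x -> 0 <= P.[x] * laguerre_weight a x.
  by move=> x0; rewrite mulr_ge0 ?P0 ?laguerre_weight_ge0.
split=> [|LP0].
  rewrite -[X in 0 <= X]/(laguerre_functional a P) PE.
  by apply: Rintegral_ge0 => x; rewrite /= in_itv/= andbT => /Pw0.
apply/eqP; apply: contraT => PN0.
have mPw := proj1 (integrableP _ _ _ Pi).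
have PI0 : (\int[mu]_(x in `[0%R, +oo[) (P.[x] * laguerre_weight a x)%:E = 0)%E.
  rewrite -[LHS]fineK; last exact: integrable_fin_num.
  by congr EFin; rewrite -[RHS]LP0; symmetry; exact: PE.
have absPw0 : (\int[mu]_(x in `[0%R, +oo[)
    `|(EFin \o (fun x => P.[x] * laguerre_weight a x)%R) x| = 0)%E.
  rewrite -PI0; apply: eq_integral => x; rewrite inE/= in_itv/= andbT => x0.
  by rewrite ger0_norm// Pw0.
have [N [mN N0 sN]] :=
  proj1 (@ae_eq_integral_abs _ _ _ mu `[0, +oo[%classic (measurable_itv _) _ mPw) absPw0.
(* A nonzero P has no root beyond its Cauchy bound, so the null set N off which P w vanishes would
   contain an interval of length 1. *)
pose M : R := Num.max 0 (polyrcf.cauchy_bound P).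
have sMN : `]M, (M + 1)[%classic `<=` N.
  move=> x; rewrite /= in_itv/= => /andP[Mx _]; apply: sN => /=.
  have x0 : 0 < x by rewrite (le_lt_trans _ Mx)// le_max lexx.
  rewrite in_itv/= andbT => /(_ (ltW x0)) [] /eqP.
  rewrite mulf_eq0 (gt_eqF (laguerre_weight_gt0 a x0)) orbF => Px0.
  have := polyrcf.cauchy_boundP PN0 (eqP Px0).
  by rewrite ltNge gtr0_norm// ltW// (le_lt_trans _ Mx)// le_max lexx orbT.
have : (mu (`]M, (M + 1)[%classic)%R <= mu N)%E.
  by apply: le_measure; [rewrite inE; exact: measurable_itv|rewrite inE|].
rewrite [X in (_ <= X)%E]N0 lebesgue_measure_itv/= lte_fin
  ltrDl ltr01 -EFinB addrAC subrr add0r.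
by rewrite lee_fin ler10.
Qed.

End LaguerreFunctional.

(** * Integrals over the quadrant *)

Section QuadrantIntegral.
Context {R : realType} (a b : R).
Hypotheses (a1 : -1 < a) (b1 : -1 < b).
Implicit Types (f g : {poly {poly R}}).
Local Notation mu := (@lebesgue_measure R).
Local Notation monomial := (fun (i j : nat) (z : R * R) =>
  (z.1 ^+ i * laguerre_weight a z.1) * (z.2 ^+ j * laguerre_weight b z.2)).

Lemma measurable_quadrant : measurable (@quadrant R).
Proof. by apply: measurableX; exact: measurable_itv. Qed.

Lemma Rintegral_quadrant f :
  \int[lebesgue2]_(z in quadrant) (f.[z.1, z.2] * product_weight a b z)
  = tensor_functional (laguerre_functional a) (laguerre_functional b) f.
Proof.
have mono i j := @Rintegral_prod _ _ _ _ R mu mu _ _ _ _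
  (measurable_itv _) (measurable_itv _) (integrable_laguerre i a1)
  (integrable_laguerre j b1).
have inner i := @Rintegral_lincomb _ _ R lebesgue2 quadrant _
  (index_enum 'I_(size f`_i)) (fun j => f`_i`_j) (fun j => monomial i j)
  measurable_quadrant (fun j => proj1 (mono i j)).
(* The coefficients 1 let the same lemma split the sum over powers of x, each term being itself a
   combination of monomials. *)
have [_ outer] := @Rintegral_lincomb _ _ R lebesgue2 quadrant _
  (index_enum 'I_(size f)) (fun=> 1) _
  measurable_quadrant (fun i => proj1 (inner i)).
transitivity (\sum_(i < size f) 1 * \sum_(j < size f`_i)
    f`_i`_j * (laguerre_moment a i * laguerre_moment b j)).
  rewrite -[RHS](_ : \sum_(i < size f) 1 * \int[lebesgue2]_(z in quadrant)
    (\sum_(j < size f`_i) f`_i`_j * monomial i j z) = _); last first.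
    apply: eq_bigr => i _; congr (1 * _); have [_ ->] := inner i.
    by apply: eq_bigr => j _; have [_ ->] := mono i j.
  rewrite -outer; apply: eq_Rintegral => z _.
  rewrite (horner_coef f) horner_sum mulr_suml; apply: eq_bigr => i _.
  rewrite mul1r hornerM horner_exp hornerC horner_coef !mulr_suml.
  by apply: eq_bigr => j _; rewrite /product_weight; ring.
rewrite /tensor_functional [RHS](@laguerre_functional_wide _ a (size f)) ?size_poly//.
apply: eq_bigr => i _; rewrite mul1r coef_map /= /laguerre_functional mulr_suml.
by apply: eq_bigr => j _; ring.
Qed.

Lemma grad_ip_tensor f g : grad_ip a b f g = normalization a b *
  tensor_functional (laguerre_functional a) (laguerre_functional b)
    (dx f * dx g + dy f * dy g).
Proof.
rewrite /grad_ip -Rintegral_quadrant; congr (_ * _).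
by apply: eq_Rintegral => z _; rewrite !hornerE.
Qed.

Lemma normalization_tensor1 : normalization a b *
  tensor_functional (laguerre_functional a) (laguerre_functional b) 1 = 1.
Proof.
have -> : normalization a b
    = (tensor_functional (laguerre_functional a) (laguerre_functional b) 1)^-1.
  rewrite -Rintegral_quadrant; congr (_^-1); apply: eq_Rintegral => z _.
  by rewrite [1.[_, _]](_ : _ = 1) ?mul1r// !hornerE.
rewrite mulVf//; apply/eqP; rewrite -[X in tensor_functional _ _ X]mulr1.
have [_ H] := tensor_functional_sqr 1
  (positive_functional_laguerre a1) (positive_functional_laguerre b1).
by move=> /H /eqP; rewrite oner_eq0.
Qed.

End QuadrantIntegral.

Lemma orthogonal_poly_laguerre (R : realType) (a : R) n p : -1 < a ->
  monic_orthogonal (laguerre_weight a) n p ->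
  orthogonal_poly (laguerre_functional a) n p.
Proof.
move=> a1 [pm sp pT]; split=> // T sT.
have [_ E] := laguerre_functionalE (p * T) a1; rewrite [LHS]E -[RHS](pT T sT).
by apply: eq_Rintegral => x _; rewrite hornerM.
Qed.

(** Invertibility is part of the conclusion because [invmx] returns a singular matrix unchanged. The
    final equivalence contains both existence and uniqueness of A_n, and the recursion for n >= 2 is
    indexed by n + 1 with n >= 1. *)
Theorem theorem3p5 (R : realType) (alpha beta : R)
    (halpha : -1 < alpha) (hbeta : -1 < beta)
    (pa pb : nat -> {poly R})
    (hpa : forall n : nat, monic_orthogonal (laguerre_weight alpha) n (pa n))
    (hpb : forall n : nat, monic_orthogonal (laguerre_weight beta) n (pb n))
    (S_ : forall n : nat, 'cV[{poly {poly R}}]_n.+1)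
    (hS : forall (n : nat) (k : 'I_n.+1), (1 <= n)%N ->
       monic_sobolev_orthogonal alpha beta n k (S_ n k 0)) :
  let Q := Qvec pa pb in
  let C := fun n : nat => grad_mx alpha beta (Q n.+1) (Q n) in
  let D := fun n : nat => grad_mx alpha beta (Q n) (Q n) in
  let H := fun n : nat => grad_mx alpha beta (S_ n) (S_ n) in
  [/\ forall n : nat, (1 <= n)%N -> H n \in unitmx,
      H 1%N = 1%:M,
      forall n : nat, (1 <= n)%N ->
        H n.+1 = D n.+1 - C n *m invmx (H n) *m (C n)^T
    & forall n : nat, (1 <= n)%N -> forall A : 'M[R]_(n.+2, n.+1),
        eq_upto_const (Q n.+1) (S_ n.+1 + const_mx_poly A *m S_ n)
        <-> A = C n *m invmx (H n)].
Proof.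
apply: (sobolev_recursion (positive_functional_laguerre halpha)
  (positive_functional_laguerre hbeta) (grad_ip_tensor halpha hbeta)
  (normalization_tensor1 halpha hbeta) (pearson_laguerre halpha)
  (pearson_laguerre hbeta)).
- by move=> n; exact: orthogonal_poly_laguerre.
- by move=> n; exact: orthogonal_poly_laguerre.
- exact: hS.
Qed.
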